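(* Let $\theta^{\min}_n(k)$ and $\theta^{\max}_n(k)$ denote the minimal, respectively maximal, possible dimension of an ad-nilpotent ideal in $\mathcal I^n$ whose class of nilpotence is $k$. Then $$\theta^{\min}_n(k)=\binom{k+1}{2}+(k-1)(n-k)$$ and $$\theta^{\max}_n(k)=\binom{n+1}{2}-(n+1)\left\lfloor\frac{n+1}{k+1}\right\rfloor+(k+1)\binom{\lfloor (n+1)/(k+1)\rfloor+1}{2}.$$
   Context: Let $\mathfrak g=sl(n+1,\mathbb C)$ (type $A_n$, rank $n$) with a fixed Cartan subalgebra $\mathfrak h$, positive roots $\Delta^+$, root spaces $\mathfrak g_\alpha$, and Borel subalgebra $\mathfrak b=\mathfrak h\oplus\bigoplus_{\alpha\in\Delta^+}\mathfrak g_\alpha$. $\mathcal I^n$ is the set of ad-nilpotent ideals of $\mathfrak b$, i.e. ideals of $\mathfrak b$ consisting of ad-nilpotent elements. For $\mathfrak i\in\mathcal I^n$ put $\mathfrak i^1=\mathfrak i$ and $\mathfrak i^{m}=[\mathfrak i^{m-1},\mathfrak i]$. The class of nilpotence of $\mathfrak i$ is the smallest $m\ge0$ such that $m$-fold bracketing of $\mathfrak i$ with itself gives zero, i.e. $\mathfrak i^{m+1}=0$ (so the zero ideal has class $0$, and Abelian ideals are exactly those of class at most $1$). Binomial coefficients: for integers $a,b$, $\binom{a}{b}=\frac{a!}{(a-b)!\,b!}$ if $a\ge b>0$, $\binom{a}{0}=1$, and $\binom{a}{b}=0$ in any other case.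
   Formalization: The formula for the minimal dimension is stated for 1 ≤ k ≤ n only, since at k = 0 the zero ideal has dimension 0 while the formula gives −n; the maximal formula is stated for 0 ≤ k ≤ n, the classes that occur. *)

(* Defs.v *)
From HB Require Import structures.
From mathcomp Require Import all_boot all_order all_algebra.
From mathcomp Require Export complex reals.

Set Implicit Arguments.
Unset Strict Implicit.
Unset Printing Implicit Defensive.

Import Order.TTheory GRing.Theory Num.Theory.
Local Open Scope ring_scope.

Section SpecialLinear.
Variables (F : fieldType) (N : nat).
Implicit Types (x y : 'M[F]_N) (U V W h b i : {vspace 'M[F]_N}).

Definition lie x y : 'M[F]_N := x *m y - y *m x.

Fact lie_is_linear x : linear (lie x).
Proof.
move=> a y z; rewrite /lie mulmxDr mulmxDl -scalemxAr -scalemxAl scalerBr.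
by rewrite opprD addrACA.
Qed.

HB.instance Definition _ x :=
  GRing.isLinear.Build F 'M[F]_N 'M[F]_N *:%R (lie x) (lie_is_linear x).

Lemma lieC x y : lie x y = - lie y x.
Proof. by rewrite /lie opprB. Qed.

Lemma lieZr (a : F) x y : lie x (a *: y) = a *: lie x y.
Proof. by rewrite /lie -scalemxAr -scalemxAl scalerBr. Qed.

Lemma lie_sumr (I : finType) (f : I -> 'M[F]_N) x :
  lie x (\sum_j f j) = \sum_j lie x (f j).
Proof. exact: raddf_sum. Qed.

Definition ad x : 'End('M[F]_N) := linfun (lie x).

Lemma adE x y : ad x y = lie x y.
Proof. by rewrite lfunE. Qed.

Definition mxtrace_fun : 'Hom('M[F]_N, F^o) :=
  linfun (mxtrace : 'M[F]_N -> F^o).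

Definition sl : {vspace 'M[F]_N} := lker mxtrace_fun.

Lemma mem_sl x : (x \in sl) = (\tr x == 0).
Proof. by rewrite memv_ker lfunE. Qed.

(* [U, V], the span of all brackets; bases suffice by bilinearity, see
   [memv_lie_space] and [lie_space_sub]. *)
Definition lie_space U V : {vspace 'M[F]_N} :=
  <<[seq lie x y | x <- vbasis U, y <- vbasis V]>>%VS.

Lemma memv_lie_space U V x y : x \in U -> y \in V -> lie x y \in lie_space U V.
Proof.
move=> xU yV; rewrite (coord_vbasis yV) lie_sumr; apply: memv_suml => j _.
rewrite lieZr; apply: memvZ; rewrite lieC rpredN.
rewrite (coord_vbasis xU) lie_sumr; apply: memv_suml => l _.
rewrite lieZr; apply: memvZ; rewrite lieC rpredN; apply: memv_span.
by apply: allpairs_f; rewrite mem_nth ?size_tuple.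
Qed.

Lemma lie_space_sub U V W :
  (forall x y, x \in U -> y \in V -> lie x y \in W) -> (lie_space U V <= W)%VS.
Proof.
move=> sW; apply/span_subvP => _ /allpairsP [[x y] /= [xU yV ->]].
by apply: sW; apply: vbasis_mem.
Qed.

Definition ad_semisimple x : Prop :=
  exists2 s : seq 'M[F]_N,
    (forall y, y \in s -> exists c : F, lie x y = c *: y) & <<s>>%VS = sl.

(* For complex semisimple Lie algebras, a Cartan subalgebra is a maximal abelian
   subalgebra all of whose elements have a diagonalizable adjoint action. *)
Record cartan_subalgebra h : Prop := CartanSubalgebra {
  cartan_sub : (h <= sl)%VS;
  cartan_abelian : forall x y, x \in h -> y \in h -> lie x y = 0;
  cartan_maximal : forall x, x \in sl ->
    (forall y, y \in h -> lie y x = 0) -> x \in h;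
  cartan_semisimple : forall x, x \in h -> ad_semisimple x
}.

Section Roots.
Variable h : {vspace 'M[F]_N}.

Definition weight := 'Hom(subvs_of h, F^o).
Implicit Type alpha : weight.

Definition root_space alpha : {vspace 'M[F]_N} :=
  (sl :&: \bigcap_(u <- vbasis {:subvs_of h})
            passmx.leigenspace (ad (vsval u)) (alpha u))%VS.

Lemma mem_root_space alpha x :
  x \in root_space alpha <->
  x \in sl /\ forall t : subvs_of h, lie (vsval t) x = alpha t *: x.
Proof.
have eigE (u : subvs_of h) :
    (x \in passmx.leigenspace (ad (vsval u)) (alpha u))
    = (lie (vsval u) x == alpha u *: x).
  rewrite /passmx.leigenspace memv_ker !lfun_simp.
  by rewrite subr_eq0.
rewrite /root_space memv_cap; split.
  case/andP=> xsl; have: forall s : seq (subvs_of h),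
      x \in (\bigcap_(u <- s) passmx.leigenspace (ad (vsval u)) (alpha u))%VS ->
      forall u, u \in s -> lie (vsval u) x = alpha u *: x.
    elim=> [|v s IHs] //; rewrite big_cons memv_cap => /andP[]; rewrite eigE.
    move=> /eqP ev /IHs es u; rewrite inE => /predU1P[-> //|]; exact: es.
  move=> /[apply] es; split=> // t.
  rewrite (coord_vbasis (memvf t)) !linear_sum /= lieC lie_sumr -sumrN.
  rewrite scaler_suml; apply: eq_bigr => j _.
  rewrite [alpha (_ *: _)]linearZ /= lieZr -scalerN -lieC.
  by rewrite es ?scalerA ?mem_nth ?size_tuple.
case=> xsl e; rewrite xsl /=; elim: (tval _) => [|u s IHs].
  by rewrite big_nil memvf.
by rewrite big_cons memv_cap IHs eigE e eqxx.
Qed.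

Definition is_root alpha : bool := (alpha != 0) && (root_space alpha != 0%VS).

(* A choice of positive roots: a closed set of roots containing exactly one of
   alpha, - alpha for each root alpha. *)
Record positive_roots (Dp : seq weight) : Prop := PositiveRoots {
  pos_root : forall alpha, alpha \in Dp -> is_root alpha;
  pos_or_neg : forall alpha, is_root alpha ->
    (alpha \in Dp) = (- alpha \notin Dp);
  pos_closed : forall alpha beta, alpha \in Dp -> beta \in Dp ->
    is_root (alpha + beta) -> alpha + beta \in Dp
}.

Definition borel (Dp : seq weight) : {vspace 'M[F]_N} :=
  (h + \sum_(alpha <- Dp) root_space alpha)%VS.

End Roots.

Definition ad_nilpotent x : Prop :=
  exists m : nat, forall y, y \in sl -> iter m (lie x) y = 0.

Record ad_nilpotent_ideal b i : Prop := AdNilpotentIdeal {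
  ideal_sub : (i <= b)%VS;
  ideal_lie : forall x y, x \in b -> y \in i -> lie x y \in i;
  ideal_ad_nilpotent : forall x, x \in i -> ad_nilpotent x
}.

(* [lie_power i m] is i^(m+1) in the usual numbering i^1 = i. *)
Definition lie_power i (m : nat) : {vspace 'M[F]_N} :=
  iter m (fun j => lie_space j i) i.

Definition nilpotence_class i (k : nat) : Prop :=
  lie_power i k = 0%VS /\ forall m, lie_power i m = 0%VS -> (k <= m)%N.

Definition class_ideal b (k : nat) i : Prop :=
  ad_nilpotent_ideal b i /\ nilpotence_class i k.

(* Integer valued, so that the differences in closed formulas for these
   dimensions are not truncated. *)
Definition is_theta_min b (k : nat) (d : int) : Prop :=
  (exists2 i, class_ideal b k i & (\dim i)%:Z = d) /\
  (forall i, class_ideal b k i -> d <= (\dim i)%:Z).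

Definition is_theta_max b (k : nat) (d : int) : Prop :=
  (exists2 i, class_ideal b k i & (\dim i)%:Z = d) /\
  (forall i, class_ideal b k i -> (\dim i)%:Z <= d).

End SpecialLinear.

(* Main.v *)
(* In a basis of simultaneous eigenvectors, ordered by the choice of positive
   roots, the Borel subalgebra becomes the traceless upper triangular matrices.
   Its ad-nilpotent ideals are then spanned by the matrix units E_ij with
   i < f (j + 1), for the nondecreasing f : nat -> nat with f x <= x - 1. The
   m-th power of the ideal of f is the ideal of the m-th iterate of f, so with
   N = n + 1 the class is k iff f^(k+1) N = 0 < f^k N, and the dimension is
   the sum of f over [0, N]. The extremal values follow by induction along the
   orbit of N under f: for the maximum, the orbit cuts [0, N] into k + 1 blocks
   and equal blocks are best. *)
From HB Require Import structures.
Require Import Defs.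
From mathcomp Require Import all_boot all_order all_algebra all_fingroup.
From mathcomp Require Import complex reals zify ring.

Set Implicit Arguments.
Unset Strict Implicit.
Unset Printing Implicit Defensive.

Import Order.TTheory GRing.Theory Num.Theory.
Local Open Scope ring_scope.

(* [f] encodes the set of positive roots (i, j) with [i < f j.+1]; the shift of
   the column index makes composition of functions match brackets of ideals. *)
Definition ideal_fun (f : nat -> nat) : Prop :=
  {homo f : x y / (x <= y)%N} /\ forall x, (f x <= x.-1)%N.

Definition fun_sum (f : nat -> nat) (M : nat) : nat := (\sum_(x < M.+1) f x)%N.

(** * Ideal functions: bounds on their sums along orbits, and functions that attain them *)

Section IdealFun.
Variable f : nat -> nat.
Hypothesis ff : ideal_fun f.

Lemma ideal_fun0 : f 0 = 0%N.
Proof. by case: ff => _ /(_ 0); case: (f 0). Qed.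

Lemma iter_ideal_fun m : ideal_fun (iter m.+1 f).
Proof.
case: ff => fm fd; elim: m => [|m [IHm IHd]] //; split=> [x y xy | x].
  by rewrite 2!iterS; apply/fm/IHm.
by rewrite iterS; apply: leq_trans (fm _ _ (IHd x)) _; have := fd x.-1; lia.
Qed.

Lemma iter_ideal_fun_le m x : (iter m f x <= x - m)%N.
Proof.
case: ff => _ fd; elim: m x => [|m IHm] x; first by rewrite subn0.
by rewrite iterS; have := fd (iter m f x); have := IHm x; lia.
Qed.

Lemma fun_sum_split M : fun_sum f M = (fun_sum f (f M) + \sum_((f M).+1 <= x < M.+1) f x)%N.
Proof.
case: ff => _ /(_ M) fd; rewrite /fun_sum -!(big_mkord xpredT).
by rewrite -big_cat_nat //=; lia.
Qed.

(** By monotonicity none of the [M - f M] indices above [f M] contributes more than [f M]. *)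
Lemma fun_sum_step_le M : (fun_sum f M <= fun_sum f (f M) + (M - f M) * f M)%N.
Proof.
rewrite fun_sum_split leq_add2l -subSS -sum_nat_const_nat.
by rewrite !big_nat; apply: leq_sum => x; case: ff => fm _ ?; apply: fm; lia.
Qed.

(** Among the indices above [f M], the last contributes [f M] itself and the others at least
    [f (f M)]. *)
Lemma fun_sum_step_ge M : (0 < M)%N ->
  (fun_sum f (f M) + f M + (M - (f M).+1) * f (f M) <= fun_sum f M)%N.
Proof.
move=> M_gt0; case: ff => fm fd; rewrite (fun_sum_split M).
have fdM := fd M; rewrite big_nat_recr /=; last by lia.
rewrite -addnA leq_add2l [leqRHS]addnC leq_add2l -sum_nat_const_nat.
by rewrite !big_nat; apply: leq_sum => x ?; apply: fm; lia.
Qed.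

(* Each block of length [d] between consecutive iterates contributes
   [d ^ 2 >= (2 q + 1) d - q (q + 1)], that is [(d - q) (d - q - 1) >= 0]. *)
Lemma fun_sum_max q j M : iter j f M = 0%N ->
  (2 * fun_sum f M + (2 * q + 1) * M <= M * M + j * (q * (q + 1)))%N.
Proof.
elim: j M => [|j IHj] M.
  by move=> /= ->; rewrite /fun_sum big_ord1 /= ideal_fun0; lia.
rewrite iterSr => /IHj IH.
have := fun_sum_step_le M; have [_ /(_ M)] := ff.
move: IH; move: (f M) (fun_sum f M) (fun_sum f (f M)) => M' S S' IH fd le_S.
have [d def_M] : exists d, M = (M' + d)%N by exists (M - M')%N; lia.
have : (2 * q * d + d <= d * d + q * (q + 1))%N.
  have [ltdq|ledq] := leqP d q.
    have [e ->] : exists e, q = (d + e)%N by exists (q - d)%N; lia.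
    by nia.
  have [e ->] : exists e, d = (q + e).+1 by exists (d - q.+1)%N; lia.
  by nia.
have : (S <= S' + d * M')%N by move: le_S; rewrite def_M addKn.
by rewrite def_M; nia.
Qed.

(** Induction along the orbit of [M]: a long positive orbit keeps [f (f M)] large, so every index
    strictly between [f M] and [M] contributes enough. Doubling and moving the square to the right
    keep the bound in [nat]. *)
Lemma fun_sum_min k M : (0 < iter k.+1 f M)%N ->
  (2 * k * M.-1 + 3 * k.+1 <= 2 * fun_sum f M + k.+1 * k.+1)%N.
Proof.
elim: k M => [|k IHk] M.
  move=> /= fM; have [_ /(_ M) fd] := ff; rewrite (fun_sum_split M).
  by rewrite big_nat_recr /=; lia.
rewrite iterSr => fM; have IH := IHk _ fM.
(* Each application of [f] lowers a positive value, and [k] more of them leave [f (f M)]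
   positive. *)
have lekM : (k.+1 <= f (f M))%N.
  by have := iter_ideal_fun_le k (f (f M)); rewrite -iterSr; lia.
have [_ fd] := ff; have fdM := fd M; have fdfM := fd (f M).
have M_gt0 : (0 < M)%N by lia.
have := fun_sum_step_ge M_gt0.
have : (k.+1 * (M - (f M).+1) <= (M - (f M).+1) * f (f M))%N by rewrite mulnC leq_mul2l lekM orbT.
have [e def_M] : exists e, M = ((f M).+1 + e)%N by exists (M - (f M).+1)%N; lia.
have -> : (M - (f M).+1 = e)%N by lia.
have -> : (M.-1 = f M + e)%N by lia.
have [g def_f] : exists g, f M = g.+1 by exists (f M).-1; lia.
move: IH; rewrite def_f /=.
by nia.
Qed.

End IdealFun.

(** Cut [M] into [j] blocks of length [q] or [q.+1] and let [f] be constant on each block, equal to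
    its lower end. These two lengths are the zeros of [(d - q) (d - q - 1)], so the bound of
    [fun_sum_max] is attained. *)
Lemma ideal_fun_max_exists q j M : (0 < q)%N -> (j * q <= M <= j * q.+1)%N ->
  exists f, [/\ ideal_fun f, iter j f M = 0%N,
    forall i, (i < j)%N -> (0 < iter i f M)%N &
    (2 * fun_sum f M + (2 * q + 1) * M = M * M + j * (q * (q + 1)))%N].
Proof.
move=> q_gt0; elim: j M => [|j IHj] M le_M.
  have -> : M = 0%N by lia.
  by exists (fun=> 0%N); split=> //; rewrite ?/fun_sum ?big_ord1 /=; lia.
(* The top block has length [q] if the rest fits into [j] blocks of length at most [q.+1], and
   [q.+1] otherwise. *)
have [d [dq ledM le_Md]] : exists d, [/\ d = q \/ d = q.+1, (d <= M)%N &
    (j * q <= M - d <= j * q.+1)%N].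
  have [leM|ltM] := leqP M (j * q.+1 + q); first by exists q; split; [left | nia | nia].
  by exists q.+1; split; [right | nia | nia].
have d_gt0 : (0 < d)%N by lia.
have [f [[fm fd] fj fi fS]] := IHj _ le_Md.
pose f' x := if (x <= M - d)%N then f x else (M - d)%N.
have f'i i : iter i f' (M - d)%N = iter i f (M - d)%N.
  elim: i => //= i ->; rewrite /f'.
  by have /= -> := leq_trans (iter_ideal_fun_le (conj fm fd) i (M - d)) (leq_subr _ _).
have f'M : f' M = (M - d)%N by rewrite /f'; case: ifP => //; lia.
exists f'; split.
- split=> [x y lexy|x]; rewrite /f'.
    case: ifP => lex; case: ifP => ley //; try lia; first exact: fm.
    by have := fd x; lia.
  by case: ifP => // lex; lia.
- by rewrite iterSr f'M f'i.
- case=> [|i] lt_ij; first by rewrite /=; lia.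
  by rewrite iterSr f'M f'i fi.
have -> : fun_sum f' M = (fun_sum f (M - d) + d * (M - d))%N.
  rewrite /fun_sum -!(big_mkord xpredT) (big_cat_nat (n := (M - d).+1)) //=; last by lia.
  congr addn; first by rewrite !big_nat; apply: eq_bigr => x lex; rewrite /f'; case: ifP => //; lia.
  rewrite big_nat (eq_bigr (fun=> (M - d)%N)) => [|x lex]; last first.
    by rewrite /f'; case: ifP => //; lia.
  by rewrite -big_nat sum_nat_const_nat; congr muln; lia.
have [e def_M] : exists e, M = (e + d)%N by exists (M - d)%N; lia.
move: fS; rewrite def_M addnK.
by case: dq => ->; nia.
Qed.

(** The orbit jumps from [n.+1] to [k.+1] and then descends by ones; between [k.+1] and [n] the
    function keeps the value [k] of [f k.+1], the least that monotonicity allows. *)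
Lemma ideal_fun_min_exists k n : (k < n)%N ->
  exists f, [/\ ideal_fun f, iter k.+2 f n.+1 = 0%N,
    (0 < iter k.+1 f n.+1)%N &
    (2 * fun_sum f n.+1 + k.+1 * k.+1 = 2 * k * n + 3 * k.+1)%N].
Proof.
move=> lt_kn; pose f x := if (x <= n)%N then minn x.-1 k else k.+1.
have f_iter i : (i <= k.+1)%N -> iter i f k.+1 = (k.+1 - i)%N.
  elim: i => //= i IHi le_i; rewrite IHi /f; last by lia.
  by case: ifP; lia.
have fn : f n.+1 = k.+1 by rewrite /f ltnn.
exists f; split.
- split=> [x y|x]; rewrite /f; last by case: ifP; lia.
  by do 2!case: ifP; lia.
- by rewrite iterSr fn f_iter // subnn.
- by rewrite iterSr fn f_iter //; lia.
rewrite /fun_sum big_ord_recr /= fn.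
have -> : (\sum_(x < n.+1) f x = \sum_(x < n.+1) minn x.-1 k)%N.
  by apply: eq_bigr => x _; rewrite /f -ltnS ltn_ord.
suff H m : (k < m)%N -> (2 * (\sum_(x < m.+1) minn x.-1 k) + k * k.+1 = 2 * k * m)%N.
  by have := H _ lt_kn; nia.
elim: m => // m IHm; rewrite ltnS leq_eqVlt => /predU1P[<-|lt_km].
  (* Base case [m = k.+1]: every term is [x.-1], so the sum is triangular. *)
  elim: {IHm lt_kn f f_iter fn} k => [|k IHk]; first by rewrite !big_ord_recr big_ord0.
  rewrite big_ord_recr /=.
  rewrite (eq_bigr (fun x : 'I_ _ => minn x.-1 k)) => [|x _]; last by have := ltn_ord x; lia.
  by rewrite minnn; move: IHk; move: (\sum_(_ < _) _)%N => S IHk; nia.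
rewrite big_ord_recr /=; have := IHm lt_km; rewrite (minn_idPr (ltnW lt_km)).
by move: (\sum_(_ < _) _)%N => S IH; nia.
Qed.

(** * Change of basis and spans of conjugated matrix units *)

Section Conjugation.
Variables (F : fieldType) (N : nat).
Implicit Types (P x y : 'M[F]_N).

Definition mxconj P x : 'M[F]_N := P *m x *m invmx P.

Fact mxconj_is_linear P : linear (mxconj P).
Proof.
by move=> a x y; rewrite /mxconj mulmxDr mulmxDl -scalemxAr -scalemxAl.
Qed.

HB.instance Definition _ P :=
  GRing.isLinear.Build F 'M[F]_N 'M[F]_N *:%R (mxconj P) (mxconj_is_linear P).

Variable P : 'M[F]_N.
Hypothesis Pu : P \in unitmx.

Lemma mxconjK : cancel (mxconj P) (mxconj (invmx P)).
Proof. by move=> x; rewrite /mxconj invmxK !mulmxA mulVmx // mul1mx mulmxKV. Qed.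

Lemma mxconjVK : cancel (mxconj (invmx P)) (mxconj P).
Proof. by move=> x; rewrite /mxconj invmxK !mulmxA mulmxV // mul1mx mulmxK. Qed.

Lemma mxconj_mul x y : mxconj P (x *m y) = mxconj P x *m mxconj P y.
Proof. by rewrite /mxconj !mulmxA mulmxKV. Qed.

Lemma mxconj_lie x y : mxconj P (lie x y) = lie (mxconj P x) (mxconj P y).
Proof. by rewrite /lie linearB /= !mxconj_mul. Qed.

Lemma mxtrace_conj x : \tr (mxconj P x) = \tr x.
Proof. by rewrite /mxconj mxtrace_mulC mulmxA mulVmx // mul1mx. Qed.

Lemma mxconj_iter_lie m x y :
  mxconj P (iter m (lie x) y) = iter m (lie (mxconj P x)) (mxconj P y).
Proof. by elim: m => //= m IHm; rewrite mxconj_lie IHm. Qed.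

Definition mxconj_unit (i j : 'I_N) : 'M[F]_N := mxconj (invmx P) (delta_mx i j).

Lemma mxconj_unitK i j : mxconj P (mxconj_unit i j) = delta_mx i j.
Proof. exact: mxconjVK. Qed.

(** Diagonal positions are allowed in [S], so that all upper triangular matrices also form such a
    span. *)
Definition root_span (S : pred ('I_N * 'I_N)) : {vspace 'M[F]_N} :=
  <<[seq mxconj_unit p.1 p.2 | p <- enum S]>>%VS.

Lemma mem_root_span S x : x \in root_span S <->
  forall i j, ~~ S (i, j) -> mxconj P x i j = 0.
Proof.
split=> [xS i j Sij | xS].
  have /coord_span -> : x \in <<in_tuple [seq mxconj_unit p.1 p.2 | p <- enum S]>>%VS by [].
  rewrite linear_sum summxE big1 // => l _; rewrite linearZ /= mxE.
  have /mapP[p] : (in_tuple [seq mxconj_unit p.1 p.2 | p <- enum S])`_l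
    \in [seq mxconj_unit p.1 p.2 | p <- enum S] by rewrite mem_nth ?size_tuple.
  rewrite mem_enum => Sp ->; rewrite mxconj_unitK mxE -xpair_eqE -surjective_pairing.
  by case: eqP => [def_p|_]; [case/negP: Sij; rewrite def_p; apply: Sp | rewrite mulr0].
rewrite -[x]mxconjK [mxconj P x]matrix_sum_delta linear_sum.
apply: memv_suml => i _; rewrite linear_sum; apply: memv_suml => j _.
rewrite linearZ /=; have [Sij|/xS ->] := boolP (S (i, j)); last by rewrite scale0r mem0v.
by apply/memvZ/memv_span/mapP; exists (i, j); rewrite ?mem_enum.
Qed.

Lemma dim_root_span S : \dim (root_span S) = #|S|.
Proof.
rewrite cardE -(size_map (fun p => mxconj_unit p.1 p.2)).
apply/eqP; change (free (in_tuple [seq mxconj_unit p.1 p.2 | p <- enum S])).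
set X := in_tuple _; apply/freeP => k k0 i.
have sz_lt (j : 'I_(size [seq mxconj_unit p.1 p.2 | p <- enum S])) : (j < size (enum S))%N.
  by have := ltn_ord j; rewrite {2}size_map.
have p0 : 'I_N * 'I_N by have := sz_lt i; move: (nat_of_ord i) => m; case: (enum S).
have nthX (j : 'I_(size [seq mxconj_unit p.1 p.2 | p <- enum S])) :
    mxconj P X`_j = delta_mx (nth p0 (enum S) j).1 (nth p0 (enum S) j).2.
  by rewrite /X /= (nth_map p0) ?mxconj_unitK.
(* Reading the vanishing combination at the [i]-th position of [S] isolates its [i]-th
   coefficient. *)
have := congr1 (fun x => mxconj P x (nth p0 (enum S) i).1 (nth p0 (enum S) i).2) k0.
rewrite linear_sum summxE (bigD1 i) //= big1 => [|j ne_ji].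
  by rewrite linearZ /= linear0 mxE [RHS]mxE nthX mxE !eqxx mulr1 addr0.
rewrite linearZ /= mxE nthX mxE -xpair_eqE -!surjective_pairing.
rewrite nth_uniq ?enum_uniq //.
by rewrite [_ == _](negPf _) ?mulr0 // eq_sym.
Qed.

End Conjugation.

(** * Matrix units and brackets with upper triangular matrices *)

Section MatrixFacts.
Variables (F : fieldType) (N : nat).
Implicit Types (x y t : 'M[F]_N) (a b : 'I_N).

Lemma lieE x y i j :
  lie x y i j = \sum_k x i k * y k j - \sum_k y i k * x k j.
Proof. by rewrite !mxE. Qed.

Lemma lie_eq0 x y i j : (forall k, x i k * y k j = 0) ->
  (forall k, y i k * x k j = 0) -> lie x y i j = 0.
Proof. by move=> xy yx; rewrite lieE !big1 ?subr0. Qed.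

Lemma lie_sub_scalar (c : F) x y : lie (x - c%:M) y = lie x y.
Proof.
by rewrite /lie mulmxBl mulmxBr mul_scalar_mx mul_mx_scalar opprB addrA subrK.
Qed.

Lemma delta_mul_delta a b x :
  delta_mx a a *m x *m delta_mx b b = x a b *: delta_mx a b.
Proof.
(* Each idempotent is factored as a column times a row, which leaves a 1 by 1 matrix in the
   middle. *)
rewrite -(mul_delta_mx (0 : 'I_1) a a) -(mul_delta_mx (0 : 'I_1) b b).
rewrite !mulmxA -(mulmxA (delta_mx a 0)) -rowE -(mulmxA (delta_mx a 0)) -colE.
rewrite [col _ _]mx11_scalar !mxE mul_mx_scalar -scalemxAl.
by rewrite mul_delta_mx.
Qed.

Lemma mxtrace_delta a b : \tr (delta_mx a b : 'M[F]_N) = (a == b)%:R.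
Proof.
rewrite /mxtrace (bigD1 a) //= big1 => [|k /negPf ne_ka]; last by rewrite mxE ne_ka.
by rewrite mxE eqxx addr0.
Qed.

Definition upper t : Prop := forall i j : 'I_N, (j < i)%N -> t i j = 0.

Lemma upper_delta a b : (a <= b)%N -> upper (delta_mx a b).
Proof.
move=> le_ab i j lt_ji; rewrite mxE; case: andP => // -[/eqP def_i /eqP def_j].
by move: lt_ji; rewrite def_i def_j ltnNge le_ab.
Qed.

(** Bracketing with an upper triangular [t] spreads entries only upwards and to the right, so
    [(a, b)] stays the corner of the support and is merely scaled each time. *)
Lemma iter_lie_upper t a b m : upper t ->
  (forall i j : 'I_N, ~~ ((i <= a) && (b <= j))%N ->
     iter m (lie t) (delta_mx a b) i j = 0)
  /\ iter m (lie t) (delta_mx a b) a b = (t a a - t b b) ^+ m.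
Proof.
move=> tU; elim: m => [|m [IH0 IHab]].
  split=> [i j ne_ij|]; rewrite /= mxE ?eqxx //.
  by case: andP => // -[/eqP e1 /eqP e2]; case/negP: ne_ij; rewrite e1 e2 !leqnn.
split=> [i j ne_ij|]; rewrite iterS.
  apply: lie_eq0 => k.
    have [lt|le] := ltnP k i; first by rewrite (tU _ _ lt) mul0r.
    rewrite IH0 ?mulr0 //; apply: contra ne_ij => /andP[le_ka ->].
    by rewrite (leq_trans le le_ka).
  have [lt|le] := ltnP j k; first by rewrite (tU _ _ lt) mulr0.
  rewrite IH0 ?mul0r //; apply: contra ne_ij => /andP[-> le_bk].
  by rewrite (leq_trans le_bk le).
rewrite lieE (bigD1 a) //= big1 => [|k ne_ka]; last first.
  have [lt|le] := ltnP k a; first by rewrite (tU _ _ lt) mul0r.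
  rewrite IH0 ?mulr0 //; apply: contra ne_ka => /andP[le' _].
  by apply/eqP/val_inj/eqP; rewrite eqn_leq le le'.
rewrite (bigD1 b) //= big1 => [|k ne_kb]; last first.
  have [lt|le] := ltnP b k; first by rewrite (tU _ _ lt) mulr0.
  rewrite IH0 ?mul0r //; apply: contra ne_kb => /andP[_ le'].
  by apply/eqP/val_inj/eqP; rewrite eqn_leq le le'.
by rewrite IHab !addr0 exprS mulrBl [_ * t b b]mulrC.
Qed.

End MatrixFacts.

(** * Ad-nilpotent ideals of the traceless upper triangular matrices *)

Section Ideals.
Variables (F : numFieldType) (n : nat).
Local Notation N := n.+1.
Variables (P : 'M[F]_N) (b : {vspace 'M[F]_N}).
Hypothesis Pu : P \in unitmx.
Hypothesis mem_b : forall x, x \in b <-> \tr x = 0 /\ upper (mxconj P x).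

Let trace_eq0 (t : 'M[F]_N) : (forall i j, t i i = t j j) -> \tr t = 0 -> forall i, t i i = 0.
Proof.
move=> t_eq; rewrite /mxtrace => + i; rewrite (eq_bigr (fun=> t i i)) => [|j _]; last exact: t_eq.
by rewrite sumr_const card_ord => /eqP; rewrite mulrn_eq0 => /eqP.
Qed.

(** Iterated brackets with the unit at [(i, j)] show a power of the difference of two diagonal
    entries, which must vanish; a constant diagonal of trace 0 is zero in characteristic 0. *)
Lemma ad_nilpotent_upper_diag x : \tr x = 0 -> upper (mxconj P x) ->
  ad_nilpotent x -> forall i, mxconj P x i i = 0.
Proof.
move=> tr_x xU [m nil_x]; apply: trace_eq0; last by rewrite mxtrace_conj.
move=> i j; have [-> //|ne_ij] := eqVneq i j.
have [_] := iter_lie_upper i j m xU.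
rewrite -(mxconj_unitK Pu i j) -mxconj_iter_lie // nil_x.
  by rewrite linear0 mxE => /esym/eqP; rewrite expf_eq0 subr_eq0 => /andP[_ /eqP].
by rewrite mem_sl -(mxtrace_conj Pu) mxconj_unitK // mxtrace_delta (negPf ne_ij).
Qed.

Definition ideal_of (f : nat -> nat) : {vspace 'M[F]_N} :=
  root_span P [pred p : 'I_N * 'I_N | (p.1 < f p.2.+1)%N].

Lemma mem_ideal_of f x : x \in ideal_of f <->
  forall i j : 'I_N, (f j.+1 <= i)%N -> mxconj P x i j = 0.
Proof.
rewrite mem_root_span //; split=> xf i j.
  by rewrite leqNgt => /xf.
by rewrite /= -leqNgt => /xf.
Qed.

(** Count by columns: column [j] holds [f j.+1] positions, and the extra index 0 of [fun_sum] adds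
    [f 0 = 0]. *)
Lemma dim_ideal_of f : ideal_fun f -> \dim (ideal_of f) = fun_sum f N.
Proof.
move=> ff; rewrite dim_root_span // -sum1_card.
rewrite /fun_sum big_ord_recl /= (ideal_fun0 ff) add0n.
rewrite (eq_bigl (fun p : 'I_N * 'I_N => xpredT p.1 && (p.1 < f p.2.+1)%N)) //.
rewrite -(pair_big_dep xpredT (fun i j : 'I_N => (i < f j.+1)%N) (fun _ _ => 1%N)) /=.
rewrite (exchange_big_dep xpredT) //=; apply: eq_bigr => j _.
rewrite sum1_card; have [_ /(_ j.+1) /= fd] := ff.
have le_fN : (f j.+1 <= N)%N by have := ltn_ord j; lia.
transitivity #|[seq widen_ord le_fN x | x : 'I_(f j.+1)]|; last first.
  by rewrite card_image ?card_ord // => i i' /(congr1 val) /= e; apply: val_inj.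
apply: eq_card => i; apply/idP/imageP => [lt_if|[i' _ ->]]; last exact: (ltn_ord i').
by exists (Ordinal lt_if) => //; apply: val_inj.
Qed.

(** The last column is the longest, so the ideal is nonzero exactly when it contains the top right
    matrix unit. *)
Lemma ideal_of_eq0 f : ideal_fun f -> ideal_of f = 0%VS <-> f N = 0%N.
Proof.
move=> [fm fd]; split=> [I0|f0].
  apply/eqP; rewrite -leqn0 leqNgt; apply/negP => fN.
  have : mxconj_unit P ord0 ord_max \in ideal_of f.
    apply/mem_ideal_of => i j le_fi; rewrite mxconj_unitK // mxE.
    by case: eqP => // i0; case: eqP => // jn; move: le_fi; rewrite i0 jn /=; lia.
  rewrite I0 memv0 => /eqP /(congr1 (mxconj P)); rewrite linear0 mxconj_unitK //.
  by move=> /matrixP /(_ ord0 ord_max) /eqP; rewrite !mxE !eqxx oner_eq0.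
apply/eqP; rewrite -subv0; apply/subvP => x /mem_ideal_of x0.
rewrite memv0; apply/eqP/(can_inj (mxconjK Pu)); rewrite linear0.
apply/matrixP => i j; rewrite [RHS]mxE x0 //.
by have := fm j.+1 N (ltn_ord j); lia.
Qed.

(** A product through an intermediate index [k < f j.+1] has row [i < g k.+1], where [g] is the
    previous iterate, and [g k.+1 <= g (f j.+1)]: brackets compose the functions. *)
Lemma lie_power_ideal_of f m : ideal_fun f ->
  lie_power (ideal_of f) m = ideal_of (iter m.+1 f).
Proof.
move=> ff; elim: m => // m IHm; rewrite /lie_power iterS -/(lie_power _ _) IHm.
have [fm fd] := ff; have [gm gd] := iter_ideal_fun ff m.
apply/eqP; rewrite eqEsubv; apply/andP; split.
  apply: lie_space_sub => x y /mem_ideal_of xg /mem_ideal_of yf.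
  apply/mem_ideal_of => i j le_i; rewrite mxconj_lie //; apply: lie_eq0 => k.
    have [lt|le] := ltnP k (f j.+1); last by rewrite yf ?mulr0.
    by rewrite xg ?mul0r //; apply: leq_trans (gm _ _ lt) _; rewrite -iterSr.
  have [lt|le] := ltnP k (iter m.+1 f j.+1); last by rewrite xg ?mulr0.
  by rewrite yf ?mul0r //; apply: leq_trans (fm _ _ lt) _; rewrite -iterS.
apply/span_subvP => x /mapP[[i j]]; rewrite mem_enum inE /= => lt_i ->.
have fj := fd j.+1; have gj := gd (f j.+1); move: lt_i; rewrite -iterS iterSr => lt_i.
(* The last row allowed in column [j] serves as intermediate index, since there [k.+1 = f j.+1]
   exactly. *)
have lt_k : ((f j.+1).-1 < N)%N by have := ltn_ord j; move: fj => /=; lia.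
have def_k : (f j.+1).-1.+1 = f j.+1 by move: gj lt_i; move: (f j.+1) => [] //=; lia.
pose k := Ordinal lt_k.
suff -> : mxconj_unit P i j = lie (mxconj_unit P i k) (mxconj_unit P k j).
  apply: memv_lie_space; apply/mem_ideal_of => i' j' le_i'; rewrite mxconj_unitK // mxE.
    case: eqP => // ei; case: eqP => // ej; move: le_i'.
    by rewrite ei ej /k /= def_k leqNgt lt_i.
  case: eqP => // ei; case: eqP => // ej; move: le_i'; rewrite ei ej /=.
  by move: def_k; lia.
apply: (can_inj (mxconjK Pu)); rewrite mxconj_lie // !mxconj_unitK //.
rewrite /lie mul_delta_mx mul_delta_mx_0 ?subr0 //.
apply/eqP => e; move: gj lt_i; rewrite -e; move: fj => /=; lia.
Qed.

Lemma nilpotence_class_ideal_of f k : ideal_fun f ->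
  nilpotence_class (ideal_of f) k <->
  iter k.+1 f N = 0%N /\ (0 < iter k f N)%N.
Proof.
move=> ff; have pow0 m : lie_power (ideal_of f) m = 0%VS <-> iter m.+1 f N = 0%N.
  by rewrite lie_power_ideal_of // ideal_of_eq0 //; apply: iter_ideal_fun.
rewrite /nilpotence_class pow0; split=> [[fk min_k]|[fk fk_gt0]]; split=> //.
  case: k min_k {fk} => // k min_k; rewrite lt0n; apply/eqP => /pow0 /min_k; lia.
move=> m /pow0 fm; rewrite leqNgt; apply/negP => lt_mk; move: fk_gt0.
(* An orbit that has reached 0 stays there. *)
rewrite -(subnK lt_mk) iterD fm.
by have := iter_ideal_fun_le ff (k - m.+1) 0; lia.
Qed.

Lemma ad_nilpotent_ideal_of f : ideal_fun f -> ad_nilpotent_ideal b (ideal_of f).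
Proof.
move=> [fm fd].
have I_tri x : x \in ideal_of f -> forall i j : 'I_N, (j <= i)%N -> mxconj P x i j = 0.
  by move=> /mem_ideal_of xf i j le_ji; apply: xf; have := fd j.+1; lia.
split.
- apply/subvP => x /I_tri xT; apply/mem_b; split=> [|i j /ltnW]; last exact: xT.
  by rewrite -(mxtrace_conj Pu) /mxtrace big1 // => i _; apply: xT.
- move=> x y /mem_b[_ xU] /mem_ideal_of yf; apply/mem_ideal_of => i j le_i.
  rewrite mxconj_lie //; apply: lie_eq0 => k.
    have [lt|le] := ltnP k i; first by rewrite xU ?mul0r.
    by rewrite yf ?mulr0 //; apply: leq_trans le.
  have [lt|le] := ltnP j k; first by rewrite xU ?mulr0.
  by rewrite yf ?mul0r //; apply: leq_trans (fm _ _ _) le_i.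
move=> x /I_tri xT; exists (2 * N)%N => y _.
(* Each bracket with a strictly upper triangular matrix raises the lowest nonzero diagonal by one;
   as [j - i] lies strictly between [- N] and [N], [2 * N] brackets suffice. *)
suff low m (i j : 'I_N) : (j + N < i + m)%N -> mxconj P (iter m (lie x) y) i j = 0.
  apply: (can_inj (mxconjK Pu)); rewrite linear0; apply/matrixP => i j.
  by rewrite [RHS]mxE low //; have := ltn_ord j; lia.
elim: m i j => [|m IHm] i j lt_ji; first by have := ltn_ord i; lia.
rewrite iterS mxconj_lie //; apply: lie_eq0 => k.
  have [le|lt] := leqP k i; first by rewrite xT ?mul0r.
  by rewrite IHm ?mulr0 //; lia.
have [le|lt] := leqP j k; first by rewrite xT ?mulr0.
by rewrite IHm ?mul0r //; lia.
Qed.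

Section IdealShape.
Variable I : {vspace 'M[F]_N}.
Hypothesis idealI : ad_nilpotent_ideal b I.

Let J (x : 'M[F]_N) : bool := mxconj (invmx P) x \in I.

Let Jlie t x : upper t -> J x -> J (lie t x).
Proof.
case: idealI => _ lieI _ tU Jx.
(* [t] may have a trace; removing its central scalar part puts it into the Borel subalgebra without
   changing the bracket. *)
rewrite -(lie_sub_scalar (\tr t / N%:R)).
rewrite /J mxconj_lie ?unitmx_inv //; apply: lieI => //.
apply/mem_b; rewrite mxconjVK // mxtrace_conj ?unitmx_inv //; split=> [|i j lt_ji].
  rewrite linearB /= mxtrace_scalar -[_ / _ *+ _]mulr_natr mulfVK ?subrr //.
  by rewrite pnatr_eq0.
by rewrite !mxE tU // (_ : i == j = false) ?subr0 //; apply/eqP => e; rewrite e ltnn in lt_ji.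
Qed.

Let J_upper x : J x -> forall i j : 'I_N, (j <= i)%N -> x i j = 0.
Proof.
case: idealI => /subvP subI _ nilI Jx i j.
have [tr_x xU] := (mem_b _).1 (subI _ Jx).
rewrite leq_eqVlt => /predU1P[/val_inj -> | lt_ji].
  by rewrite -(mxconjVK Pu x) ad_nilpotent_upper_diag //; apply: nilI.
by rewrite -(mxconjVK Pu x) xU.
Qed.

Let JD x y : J x -> J y -> J (x + y).
Proof. by rewrite /J linearD; apply: memvD. Qed.

Let JZ c x : J x -> J (c *: x).
Proof. by rewrite /J linearZ; apply: memvZ. Qed.

(** For [e = delta_mx a a], the product [e x e] vanishes with the diagonal of [x], so [[e, [e, x]] +
    [e, x] = 2 e x]. *)
Let J_deltal a x : J x -> J (delta_mx a a *m x).
Proof.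
move=> Jx; have J1 := Jlie (upper_delta F (leqnn a)) Jx.
have J2 := Jlie (upper_delta F (leqnn a)) J1.
suff <- : 2%:R^-1 *: (lie (delta_mx a a) (lie (delta_mx a a) x) + lie (delta_mx a a) x)
    = delta_mx a a *m x by apply/JZ/JD.
apply: (@scalerI _ _ 2%:R); first by rewrite pnatr_eq0.
rewrite scalerA mulfV ?pnatr_eq0 // scale1r /lie mulmxBr mulmxBl !mulmxA.
rewrite mul_delta_mx delta_mul_delta (J_upper Jx) // scale0r sub0r subr0 -mulmxA mul_delta_mx.
by rewrite opprK addrACA subrr addr0 scaler_nat mulr2n.
Qed.

Let J_deltar a x : J x -> J (x *m delta_mx a a).
Proof.
move=> Jx; have J1 := Jlie (upper_delta F (leqnn a)) Jx.
have -> : x *m delta_mx a a = delta_mx a a *m x + (-1) *: lie (delta_mx a a) x.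
  by rewrite scaleN1r /lie opprB addrC subrK.
by apply: JD; [apply: J_deltal | apply: JZ].
Qed.

(** Cutting [x] down to row [i] and column [j] stays in the ideal: this splits the ideal into root
    spaces. *)
Let J_entry x i j : J x -> x i j != 0 -> J (delta_mx i j).
Proof.
move=> Jx nz_x; have := J_deltar j (J_deltal i Jx).
rewrite delta_mul_delta => /(JZ (x i j)^-1).
by rewrite scalerA mulVf // scale1r.
Qed.

Let J_lt (i j : 'I_N) : J (delta_mx i j) -> (i < j)%N.
Proof.
move=> Je; rewrite ltnNge; apply/negP => /(J_upper Je) /eqP.
by rewrite mxE !eqxx oner_eq0.
Qed.

(** Brackets with the units at [(i', i)] and [(j, j')] of the Borel subalgebra move a unit up and to
    the right. *)
Let J_up (i i' j j' : 'I_N) : (i' <= i)%N -> (j <= j')%N ->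
  J (delta_mx i j) -> J (delta_mx i' j').
Proof.
move=> le_i le_j Je; have lt_ij := J_lt Je.
have Je' : J (delta_mx i' j).
  move: le_i; rewrite leq_eqVlt => /predU1P[/val_inj -> // | lt_i].
  have := Jlie (upper_delta F (ltnW lt_i)) Je.
  rewrite /lie mul_delta_mx mul_delta_mx_0 ?subr0 //.
  by apply/eqP => e; move: lt_i lt_ij; rewrite e; lia.
move: le_j; rewrite leq_eqVlt => /predU1P[/val_inj <- // | lt_j].
have := JZ (-1) (Jlie (upper_delta F (ltnW lt_j)) Je').
rewrite /lie mul_delta_mx mul_delta_mx_0 ?sub0r ?scaleN1r ?opprK //.
by apply/eqP => e; move: lt_j lt_ij; rewrite e; lia.
Qed.

Lemma ideal_of_exists : exists2 f, ideal_fun f & I = ideal_of f.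
Proof.
(* One more than the largest row index of a unit of the ideal in the columns before [x], and 0 if
   there is none; by [J_up] the rows met in a column form an initial segment. *)
pose f x := (\max_(p : 'I_N * 'I_N | J (delta_mx p.1 p.2) && (p.2 < x)) p.1.+1)%N.
have fE i j : J (delta_mx i j) <-> (i < f j.+1)%N.
  split=> [Je|]; first by apply: (leq_bigmax_cond (i, j)); rewrite /= Je leqnn.
  rewrite ltnNge => /negP lt_if; case: (boolP (J (delta_mx i j))) => // nJ.
  case: lt_if; apply/bigmax_leqP => -[i' j'] /= /andP[Je' le_j'].
  by rewrite ltnNge; apply/negP => le_i; case/negP: nJ; apply: J_up Je'.
exists f.
  split=> [x y le_xy|x]; last first.
    by apply/bigmax_leqP => -[i j] /= /andP[/J_lt lt_ij lt_jx]; lia.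
  apply/bigmax_leqP => p /andP[Jp lt_px].
  by apply: (leq_bigmax_cond p); rewrite Jp (leq_trans lt_px).
apply/vspaceP => x; apply/idP/idP => [Ix|/mem_ideal_of xf].
  apply/mem_ideal_of => i j; rewrite leqNgt => /negP nlt.
  apply/eqP; apply/negP => /negP nz; apply: nlt; apply/fE.
  by apply: J_entry nz; rewrite /J mxconjK.
rewrite -[x](mxconjK Pu) -/(J _) [mxconj P x]matrix_sum_delta /J linear_sum.
apply: memv_suml => i _; rewrite linear_sum; apply: memv_suml => j _.
rewrite linearZ /=; have [lt|/xf ->] := ltnP i (f j.+1); last by rewrite scale0r mem0v.
by apply: memvZ; apply/fE.
Qed.

End IdealShape.

End Ideals.

(** * Simultaneous diagonalization of a Cartan subalgebra *)

Section Cartan.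
Variables (F : numClosedFieldType) (n : nat).
Local Notation N := n.+1.
Implicit Types x y t : 'M[F]_N.

Lemma sub_sum_eigenspace x (rs : seq F) m (w : 'M[F]_(m, N)) c :
  c \in rs -> w *m x = c *: w -> (w <= \sum_(r <- rs) eigenspace x r)%MS.
Proof.
by move=> c_rs /eigenspaceP wE; rewrite (big_rem c) //= (submx_trans wE) ?addsmxSl.
Qed.

(* If [v x = l v] and [[x, y] = c y] then [(v y) x = (l - c) (v y)]; since the
   [v y] fill the space when [v != 0], eigenvectors of [x] span. *)
Lemma ad_semisimple_diagonalizable x : ad_semisimple x ->
  exists2 P : 'M[F]_N, P \in unitmx & similar_diag P x.
Proof.
case=> s s_eig s_span.
have [r def_r] := closed_field_poly_normal (char_poly x).
have eig_r c : eigenvalue x c -> c \in r.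
  rewrite eigenvalue_root_char def_r (monicP (char_poly_monic x)) scale1r.
  by rewrite root_prod_XsubC.
have [l /eigenvalueP[v vx nz_v]] := eigenvalue_closed x (ltn0Sn n).
apply/diagonalizablePeigen; exists (undup r); rewrite ?undup_uniq //.
set V := (\sum_(_ <- _) _)%MS.
have vecV (w : 'rV[F]_N) c : w *m x = c *: w -> (w <= V)%MS.
  move=> wx; have [->|nz_w] := eqVneq w 0; first exact: sub0mx.
  by apply: (sub_sum_eigenspace _ wx); rewrite mem_undup eig_r //; apply/eigenvalueP; exists w.
have vyV y : (v *m y <= V)%MS.
  have -> : y = (y - (\tr y / N%:R)%:M) + (\tr y / N%:R)%:M by rewrite subrK.
  rewrite mulmxDr addmx_sub ?mul_mx_scalar ?scalemx_sub ?(vecV v l) //.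
  have : y - (\tr y / N%:R)%:M \in <<in_tuple s>>%VS.
    rewrite s_span mem_sl linearB /= mxtrace_scalar -[_ / _ *+ _]mulr_natr mulfVK ?subrr //.
    by rewrite pnatr_eq0.
  move/coord_span->; rewrite mulmx_sumr; apply: summx_sub => i _.
  rewrite -scalemxAr scalemx_sub //.
  have [|c] := s_eig (in_tuple s)`_i; first by rewrite mem_nth.
  rewrite /lie => /eqP; rewrite subr_eq => /eqP xy; apply: (vecV _ (l - c)).
  have yx : (in_tuple s)`_i *m x = x *m (in_tuple s)`_i - c *: (in_tuple s)`_i.
    by rewrite xy [RHS]addrC addKr.
  by rewrite -mulmxA yx mulmxBr mulmxA vx -scalemxAl -scalemxAr -scalerBl.
apply/eqmxP; rewrite submx1 /=; apply/row_subP => i.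
have [j nz_vj] : exists j, v 0 j != 0 by apply/rV0Pn.
(* A rank one matrix sends the nonzero vector [v] to any prescribed row. *)
have -> : row i 1%:M = v *m (delta_mx j 0 *m ((v 0 j)^-1 *: row i (1%:M : 'M[F]_N))).
  rewrite mulmxA -colE [col j v]mx11_scalar mxE mul_scalar_mx scalerA mulfV //.
  by rewrite scale1r.
exact: vyV.
Qed.

Definition diagonal t : Prop := forall i j : 'I_N, i != j -> t i j = 0.

Lemma lie_diagonal t x i j : diagonal t -> lie t x i j = (t i i - t j j) * x i j.
Proof.
move=> tD; rewrite lieE (bigD1 i) //= big1 => [|k ne_ki].
  rewrite (bigD1 j) //= big1 => [|k ne_kj].
    by rewrite !addr0 mulrBl [x i j * _]mulrC.
  by rewrite tD ?mulr0.
by rewrite tD ?mul0r // eq_sym.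
Qed.

(* The rows of [P] are simultaneous eigenvectors of the Cartan subalgebra. *)
Definition diagonalizes (P : 'M[F]_N) (h : {vspace 'M[F]_N}) : Prop :=
  P \in unitmx /\ forall x, x \in h <-> \tr x = 0 /\ diagonal (mxconj P x).

(** A basis of [h] is a commuting family of diagonalizable matrices, hence codiagonalizable.
    Conversely, a traceless matrix diagonal in the common basis centralizes [h] and lies in it by
    maximality. *)
Lemma cartan_diagonalizes (h : {vspace 'M[F]_N}) :
  cartan_subalgebra h -> exists P, diagonalizes P h.
Proof.
case=> /subvP h_sl h_ab h_max h_ss.
have [|P Pu /allP Pd] := (codiagonalizableP (vbasis h)).1.
  split=> [x y xb yb|x xb]; last exact/ad_semisimple_diagonalizable/h_ss/vbasis_mem.
  by apply/eqP; rewrite -subr_eq0; apply/eqP/h_ab; apply: vbasis_mem.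
have h_diag x : x \in h -> diagonal (mxconj P x).
  move=> xh i j ne_ij; rewrite (coord_vbasis xh) linear_sum summxE big1 // => k _.
  have /Pd /(similar_diagP _ Pu) /(_ _ _ ne_ij) e : (vbasis h)`_k \in vbasis h.
    by rewrite mem_nth ?size_tuple.
  by rewrite linearZ mxE /= [mxconj _ _ _ _]e mulr0.
exists P; split=> // x; split=> [xh|[tr_x xD]].
  by split; [apply/eqP; rewrite -mem_sl h_sl | apply: h_diag].
apply: h_max; first by rewrite mem_sl tr_x.
move=> y /h_diag yD; apply: (can_inj (mxconjK Pu)); rewrite linear0 mxconj_lie //.
apply/matrixP => i j; rewrite lie_diagonal // [RHS]mxE.
by have [->|/xD ->] := eqVneq i j; rewrite ?subrr ?mul0r ?mulr0.
Qed.

(** * Roots, root spaces and the triangular form of the Borel subalgebra *)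

Section Roots.
Variable h : {vspace 'M[F]_N}.

(** The weight eps_i - eps_j of type A in the eigenbasis given by the rows of [P]. *)
Definition diag_diff (P : 'M[F]_N) i j (t : subvs_of h) : F^o :=
  mxconj P (vsval t) i i - mxconj P (vsval t) j j.

Fact diag_diff_is_linear P i j : linear (diag_diff P i j).
Proof.
move=> a t u; rewrite /diag_diff !linearP /= ![fun_of_matrix (_ + _) _ _]mxE ![fun_of_matrix (_ *: _) _ _]mxE.
by rewrite /GRing.scale /=; ring.
Qed.

HB.instance Definition _ P i j :=
  GRing.isLinear.Build F (subvs_of h) F^o *:%R (diag_diff P i j)
    (diag_diff_is_linear P i j).

Definition diag_weight P i j : weight h := linfun (diag_diff P i j).

Lemma diag_weightE P i j (t : subvs_of h) :
  diag_weight P i j t = mxconj P (vsval t) i i - mxconj P (vsval t) j j.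
Proof. by rewrite lfunE. Qed.

Lemma diag_weightN P i j : - diag_weight P i j = diag_weight P j i.
Proof. by apply/lfunP => t; rewrite opp_lfunE !diag_weightE opprB. Qed.

Lemma diag_weightD P i j k : diag_weight P i j + diag_weight P j k = diag_weight P i k.
Proof. by apply/lfunP => t; rewrite add_lfunE !diag_weightE addrA subrK. Qed.

Lemma diag_weightxx P i : diag_weight P i i = 0.
Proof. by apply/lfunP => t; rewrite zero_lfunE diag_weightE subrr. Qed.

Lemma mxconj_row_perm (s : 'S_N) (P : 'M[F]_N) x i j : P \in unitmx ->
  mxconj (row_perm s P) x i j = mxconj P x (s i) (s j).
Proof.
move=> Pu; suff -> : mxconj (row_perm s P) x = row_perm s (col_perm s (mxconj P x)).
  by rewrite !mxE.
have sPu : row_perm s P \in unitmx by rewrite row_permE unitmx_mul unitmx_perm.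
suff e : row_perm s P *m x = row_perm s (col_perm s (mxconj P x)) *m row_perm s P.
  by rewrite /mxconj e mulmxK.
rewrite !row_permE col_permE !mulmxA -(mulmxA _ (perm_mx _) (perm_mx _)) -perm_mxM mulVg.
by rewrite perm_mx1 mulmx1 /mxconj ?mulmxA mulmxKV.
Qed.

Lemma diagonalizes_row_perm (s : 'S_N) P : diagonalizes P h ->
  diagonalizes (row_perm s P) h.
Proof.
case=> Pu memh; split=> [|x]; first by rewrite row_permE unitmx_mul unitmx_perm.
rewrite memh; split=> -[tr_x xD]; split=> // i j ne_ij.
  by rewrite mxconj_row_perm // xD // (inj_eq perm_inj).
rewrite -(permKV s i) -(permKV s j) -mxconj_row_perm // xD //.
by rewrite (inj_eq perm_inj).
Qed.

Lemma diag_weight_row_perm (s : 'S_N) P i j : P \in unitmx ->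
  diag_weight (row_perm s P) i j = diag_weight P (s i) (s j).
Proof. by move=> Pu; apply/lfunP => t; rewrite !diag_weightE !mxconj_row_perm. Qed.

Section FixedBasis.
Variable P : 'M[F]_N.
Hypothesis Ph : diagonalizes P h.
Let Pu : P \in unitmx := proj1 Ph.

Lemma coroot_in_cartan i j :
  exists t : subvs_of h, mxconj P (vsval t) = delta_mx i i - delta_mx j j.
Proof.
have th : mxconj (invmx P) (delta_mx i i - delta_mx j j) \in h.
  apply/(proj2 Ph); rewrite mxconjVK // mxtrace_conj ?unitmx_inv //; split.
    by rewrite linearB /= !mxtrace_delta !eqxx subrr.
  move=> k l ne_kl; rewrite !mxE.
  by do 2![case: andP => [[/eqP e /eqP e']|_]; first by rewrite e e' eqxx in ne_kl]; rewrite subrr.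
by exists (Subvs th); rewrite /= mxconjVK.
Qed.

(** The coroot [delta_mx i i - delta_mx j j] acts on the root space by 2, and on the matrix unit at
    [(a, b)] by 2 only for [(a, b) = (i, j)]. *)
Lemma root_space_diag_weight i j x : i != j ->
  x \in root_space (diag_weight P i j) ->
  forall a b, (a, b) != (i, j) -> mxconj P x a b = 0.
Proof.
move=> ne_ij /mem_root_space[_ x_root] a b.
have [t def_t] := coroot_in_cartan i j.
have tD : diagonal (mxconj P (vsval t)).
  by have /(proj2 Ph)[] := subvsP t.
have /(congr1 (mxconj P)) := x_root t; rewrite mxconj_lie // linearZ diag_weightE.
move=> /matrixP /(_ a b); rewrite lie_diagonal // [fun_of_matrix (_ *: _) _ _]mxE def_t.
have diagE k : (delta_mx i i - delta_mx j j) k k = (k == i)%:R - (k == j)%:R :> F.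
  by rewrite !mxE !andbb.
rewrite !diagE !eqxx (negPf ne_ij) [j == i]eq_sym (negPf ne_ij) /=.
move/eqP; rewrite -subr_eq0 -mulrBl mulf_eq0 => /orP[/eqP e|/eqP //].
have : ((a == i) + (b == j))%:R == (2 + (a == j) + (b == i))%:R :> F.
  by rewrite -subr_eq0 -e !natrD; apply/eqP; ring.
rewrite eqr_nat xpair_eqE.
by case: (a == i); case: (b == j); case: (a == j); case: (b == i).
Qed.

Lemma unit_in_root_space i j : i != j ->
  mxconj_unit P i j \in root_space (diag_weight P i j).
Proof.
move=> ne_ij; apply/mem_root_space; split.
  by rewrite mem_sl mxtrace_conj ?unitmx_inv // mxtrace_delta (negPf ne_ij).
move=> t; apply: (can_inj (mxconjK Pu)); rewrite mxconj_lie // linearZ /= !mxconj_unitK //.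
apply/matrixP => a b; rewrite lie_diagonal; last by have /(proj2 Ph)[] := subvsP t.
rewrite [RHS]mxE diag_weightE [fun_of_matrix (delta_mx _ _) _ _]mxE.
by case: andP => [[/eqP-> /eqP->]|_]; rewrite ?mulr0.
Qed.

Lemma is_root_diag_weight i j : i != j -> is_root (diag_weight P i j).
Proof.
move=> ne_ij; apply/andP; split.
  have [t def_t] := coroot_in_cartan i j.
  apply/eqP => /lfunP /(_ t) /eqP; rewrite zero_lfunE diag_weightE def_t !mxE !eqxx.
  rewrite (negPf ne_ij) [j == i]eq_sym (negPf ne_ij) subr0 sub0r opprK.
  by rewrite -natrD pnatr_eq0.
apply/eqP => e; have := unit_in_root_space ne_ij; rewrite e memv0.
move=> /eqP /(congr1 (mxconj P)); rewrite linear0 mxconj_unitK //.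
by move=> /matrixP /(_ i j) /eqP; rewrite !mxE !eqxx oner_eq0.
Qed.

(** At a nonzero entry [(i, j)] of a root vector the eigenvalue equation determines [alpha]. *)
Lemma is_rootP alpha : is_root alpha ->
  exists i j, i != j /\ alpha = diag_weight P i j.
Proof.
case/andP=> nz_a; rewrite -vpick0; set x := vpick _ => nz_x.
have /mem_root_space[_ x_root] : x \in root_space alpha := memv_pick _.
have [i [j nz_ij]] : exists i j, mxconj P x i j != 0.
  apply/matrix0Pn; rewrite -(linear0 (mxconj P)).
  by apply: contra nz_x => /eqP/(can_inj (mxconjK Pu)) ->.
have def_a : alpha = diag_weight P i j.
  apply/lfunP => t; rewrite diag_weightE; apply: (mulIf nz_ij).
  have tD : diagonal (mxconj P (vsval t)) by have /(proj2 Ph)[] := subvsP t.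
  have := congr1 (fun y => mxconj P y i j) (x_root t).
  by rewrite mxconj_lie // lie_diagonal // linearZ /= [fun_of_matrix (_ *: _) _ _]mxE => ->.
exists i, j; split=> //; apply: contra nz_a => /eqP e.
by rewrite def_a e diag_weightxx.
Qed.

Lemma mem_borel (Dp : seq (weight h)) : positive_roots Dp ->
  (forall i j : 'I_N, (i < j)%N -> diag_weight P i j \in Dp) ->
  forall x, x \in borel Dp <-> \tr x = 0 /\ upper (mxconj P x).
Proof.
case=> Dp_root Dp_neg _ Dp_lt x.
pose U := root_span P [pred p : 'I_N * 'I_N | (p.1 <= p.2)%N].
have memU y : y \in U <-> upper (mxconj P y).
  rewrite mem_root_span //; split=> yU i j; first by rewrite ltnNge => /yU.
  by rewrite /= -ltnNge => /yU.
split=> [|[tr_x xU]].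
  suff: (borel Dp <= U :&: sl F N)%VS.
    move=> /subvP sub /sub; rewrite memv_cap mem_sl => /andP[/memU xU /eqP].
    by [].
  rewrite subv_add; apply/andP; split.
    apply/subvP => y /(proj2 Ph)[tr_y yD]; rewrite memv_cap mem_sl tr_y eqxx andbT.
    by apply/memU => i j lt_ji; apply: yD; rewrite eq_sym -val_eqE neq_ltn lt_ji.
  rewrite big_seq; apply: (big_ind (fun V => (V <= U :&: sl F N)%VS)) => [|V W sV sW|alpha Da]; first exact: sub0v.
    by rewrite subv_add sV.
  rewrite subv_cap capvSl andbT; apply/subvP => y y_root; apply/memU => a b lt_ba.
  have [i [j [ne_ij def_a]]] := is_rootP (Dp_root _ Da); rewrite def_a in y_root.
  apply: (root_space_diag_weight ne_ij y_root); apply/eqP => -[ea eb].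
  (* A nonzero entry below the diagonal would place both a root and its opposite in [Dp]. *)
  have := Da; rewrite (Dp_neg _ (Dp_root _ Da)) def_a diag_weightN.
  by rewrite -ea -eb Dp_lt.
(* The diagonal part comes from [h]; the remainder is a sum of units in positive root spaces. *)
pose D := \matrix_(i, j) (mxconj P x i j *+ (i == j)).
rewrite -(mxconjK Pu x) -(subrK D (mxconj P x)) addrC linearD memv_add //.
  apply/(proj2 Ph); rewrite mxconjVK // mxtrace_conj ?unitmx_inv //; split.
    by rewrite -tr_x -(mxtrace_conj Pu x); apply: eq_bigr => i _; rewrite [LHS]mxE eqxx.
  by move=> i j /negPf ne_ij; rewrite [LHS]mxE ne_ij.
rewrite [_ - D]matrix_sum_delta linear_sum; apply: memv_suml => i _.
rewrite linear_sum; apply: memv_suml => j _; rewrite linearZ /=.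
have [lt_ij|le_ji] := ltnP i j; last first.
  have -> : (mxconj P x - D) i j = 0; last by rewrite scale0r mem0v.
  rewrite [LHS]mxE [X in _ + X]mxE [fun_of_matrix D _ _]mxE; have [->|ne_ij] := eqVneq i j.
    by rewrite subrr.
  by rewrite subr0 xU // ltn_neqAle le_ji andbT eq_sym val_eqE.
apply/memvZ/(subvP _ _ (unit_in_root_space _)); last by rewrite -val_eqE neq_ltn lt_ij.
by rewrite (big_rem _ (Dp_lt _ _ lt_ij)) addvSl.
Qed.

End FixedBasis.

(** Positivity of the weight of [(i, j)] orders the indices: the choice between opposite roots gives
    totality, closure gives transitivity. Sorting the eigenbasis by this order makes the positive
    positions those with [i < j]. *)
Lemma borel_upper (Dp : seq (weight h)) :
  cartan_subalgebra h -> positive_roots Dp ->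
  exists2 P, P \in unitmx &
    forall x, x \in borel Dp <-> \tr x = 0 /\ upper (mxconj P x).
Proof.
move=> /cartan_diagonalizes[P Ph] pos_Dp; have [Dp_root Dp_neg Dp_closed] := pos_Dp.
pose leT i j := (i == j) || (diag_weight P i j \in Dp).
have anti i j : diag_weight P i j \in Dp -> diag_weight P j i \notin Dp.
  by move=> Dij; rewrite -diag_weightN -Dp_neg ?Dp_root.
have leT_total : total leT.
  move=> i j; rewrite /leT [j == i]eq_sym; case: eqVneq => //= ne_ij.
  rewrite (Dp_neg (diag_weight P i j)) ?(is_root_diag_weight Ph) // diag_weightN.
  exact: orNb.
have leT_tr : transitive leT.
  move=> j i k /predU1P[-> //|Dij] /predU1P[<-|Djk]; first by rewrite /leT Dij orbT.
  rewrite /leT; have [//|ne_ik] := eqVneq i k.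
  by rewrite -(diag_weightD P i j k) Dp_closed ?diag_weightD ?(is_root_diag_weight Ph).
pose s := sort leT (enum 'I_N).
have sz_s : size s = N by rewrite size_sort size_enum_ord.
have s_inj : injective (fun i : 'I_N => nth ord0 s i).
  move=> i j /eqP; rewrite nth_uniq ?sz_s ?sort_uniq ?enum_uniq //.
  by move/eqP/val_inj.
have P'h := diagonalizes_row_perm (perm s_inj) Ph.
exists (row_perm (perm s_inj) P); first by case: P'h.
apply: mem_borel => // i j lt_ij; have [Pu _] := Ph.
rewrite diag_weight_row_perm // !permE.
have := sorted_ltn_nth leT_tr ord0 (sort_sorted leT_total (enum 'I_N)).
move=> /(_ i j); rewrite !inE -/s sz_s => /(_ (ltn_ord i) (ltn_ord j) lt_ij).
by case/predU1P=> // /s_inj e; rewrite e ltnn in lt_ij.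
Qed.

End Roots.
End Cartan.

(** * Extremal dimensions of ideals of a given class *)

Section ClassIdeals.
Variables (F : numFieldType) (n : nat) (P : 'M[F]_n.+1) (b : {vspace 'M[F]_n.+1}).
Hypothesis Pu : P \in unitmx.
Hypothesis mem_b : forall x, x \in b <-> \tr x = 0 /\ upper (mxconj P x).

Lemma class_idealE k I : class_ideal b k I <->
  exists f, [/\ ideal_fun f, I = ideal_of P f, iter k.+1 f n.+1 = 0%N &
                (0 < iter k f n.+1)%N].
Proof.
split=> [[idealI classI]|[f [ff -> fk0 fk_gt0]]]; last first.
  by split; [apply: ad_nilpotent_ideal_of | apply/nilpotence_class_ideal_of].
have [f ff def_I] := ideal_of_exists Pu mem_b idealI; exists f.
by move: classI; rewrite def_I => /(nilpotence_class_ideal_of Pu k ff) [].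
Qed.

Lemma double_bin2 m : (2 * 'C(m + 1, 2) = (m + 1) * m)%N.
Proof. by rewrite addn1 -mul_bin_diag /= bin1. Qed.

Lemma theta_min_upper k : (k < n)%N ->
  is_theta_min b k.+1 ('C(k.+1 + 1, 2)%:Z + (k.+1%:Z - 1) * (n%:Z - k.+1%:Z)).
Proof.
move=> lt_kn; have C2 := double_bin2 k.+1.
split=> [|I /class_idealE[f [ff -> fk0 fk_gt0]]].
  have [f [ff fk0 fk_gt0 fS]] := ideal_fun_min_exists lt_kn.
  exists (ideal_of P f); first by apply/class_idealE; exists f.
  by rewrite dim_ideal_of //; nia.
rewrite dim_ideal_of //; have /= := fun_sum_min ff fk_gt0.
nia.
Qed.

Lemma theta_max_upper k : (k <= n)%N ->
  is_theta_max b k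
    ('C(n + 1, 2)%:Z - (n%:Z + 1) * ((n + 1) %/ (k + 1))%N%:Z
     + (k%:Z + 1) * 'C((n + 1) %/ (k + 1) + 1, 2)%:Z).
Proof.
move=> le_kn; set q := ((n + 1) %/ (k + 1))%N.
have Cn := double_bin2 n; have Cq := double_bin2 q.
have Ckq : (2 * ((k + 1) * 'C(q + 1, 2)) = k.+1 * (q * (q + 1)))%N by nia.
split=> [|I /class_idealE[f [ff -> fk0 fk_gt0]]].
  have q_gt0 : (0 < q)%N by rewrite divn_gt0; lia.
  (* Euclidean division lets [k.+1] blocks of length [q] or [q.+1] fill [n.+1]. *)
  have le_q : (k.+1 * q <= n.+1 <= k.+1 * q.+1)%N.
    have := divn_eq (n + 1) (k + 1); have := ltn_pmod (n + 1) (_ : 0 < k + 1)%N.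
    by rewrite -/q addn1 => /(_ isT); nia.
  have [f [ff fk0 fk_gt0 fS]] := ideal_fun_max_exists q_gt0 le_q.
  exists (ideal_of P f); first by apply/class_idealE; exists f; split=> //; apply: fk_gt0.
  by rewrite dim_ideal_of //; nia.
rewrite dim_ideal_of //; have := fun_sum_max ff q fk0.
nia.
Qed.

End ClassIdeals.

Theorem theorem6p2 (R : realType) (n k : nat)
    (h : {vspace 'M[R[i]]_(n.+1)}) (Dp : seq (weight h))
    (n_gt0 : (0 < n)%N) (le_kn : (k <= n)%N)
    (cartan_h : cartan_subalgebra h) (pos_Dp : positive_roots Dp) :
  ((0 < k)%N ->
     is_theta_min (borel Dp) k
       ('C(k + 1, 2)%:Z + (k%:Z - 1) * (n%:Z - k%:Z)))
  /\ is_theta_max (borel Dp) k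
       ('C(n + 1, 2)%:Z - (n%:Z + 1) * ((n + 1) %/ (k + 1))%N%:Z
        + (k%:Z + 1) * 'C((n + 1) %/ (k + 1) + 1, 2)%:Z).
Proof.
have [P Pu mem_b] := borel_upper cartan_h pos_Dp.
split=> [k_gt0|]; last exact: (theta_max_upper Pu mem_b).
by case: k k_gt0 le_kn => // k _; apply: (theta_min_upper Pu mem_b).
Qed.
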